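(* Let $(M,d)$ be a multiplicative metric space, let $\xi,\eta,\lambda$ be real numbers with $\xi\in[0,1)$ and $\eta,\lambda\in[0,\frac12)$, and let $T:M\to M$ be a function such that for each pair of different points $x,y\in M$ at least one of the following conditions is satisfied: (1) $d(Tx,Ty)\le (d(x,y))^{\xi}$; (2) $d(Tx,Ty)\le \big(d(x,Tx)\cdot d(y,Ty)\big)^{\eta}$; (3) $d(Tx,Ty)\le \big(d(x,Ty)\cdot d(y,Tx)\big)^{\lambda}$. If for some $x_0\in M$ the sequence $\{T^n(x_0)\}$ has a limit point $z_1$ in $M$, then $z_1$ is the unique fixed point of $T$.
   Context: A multiplicative metric on a nonempty set $X$ is a mapping $d:X\times X\to\mathbb{R}$ such that for all $x,y,z\in X$: $d(x,y)\ge 1$; $d(x,y)=1$ if and only if $x=y$; $d(x,y)=d(y,x)$; and $d(x,z)\le d(x,y)\cdot d(y,z)$. The pair $(X,d)$ is called a multiplicative metric space. A sequence $\{x_n\}$ in $X$ converges (multiplicatively) to $x\in X$ if for every $\epsilon>1$ there is a positive integer $n_0$ with $d(x_n,x)<\epsilon$ for all $n\ge n_0$. A point $z\in X$ is a limit point of the sequence $\{x_n\}$ if some subsequence of $\{x_n\}$ converges (multiplicatively) to $z$. $T^n$ denotes the $n$-fold composition of $T$ with itself ($T^0$ is the identity). *)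

(* Defs.v *)
From Stdlib Require Import Reals.
Open Scope R_scope.

Record multiplicative_metric (X : Type) (d : X -> X -> R) : Prop := {
  mm_inhabited : inhabited X;
  mm_ge1 : forall x y : X, d x y >= 1;
  mm_eq1 : forall x y : X, d x y = 1 <-> x = y;
  mm_sym : forall x y : X, d x y = d y x;
  mm_triangle : forall x y z : X, d x z <= d x y * d y z
}.

Definition mult_converges (X : Type) (d : X -> X -> R) (u : nat -> X) (x : X)
    : Prop :=
  forall eps : R, eps > 1 ->
    exists n0 : nat, (0 < n0)%nat /\
      forall n : nat, (n0 <= n)%nat -> d (u n) x < eps.

Definition strictly_increasing (phi : nat -> nat) : Prop :=
  forall m n : nat, (m < n)%nat -> (phi m < phi n)%nat.

Definition mult_limit_point (X : Type) (d : X -> X -> R) (u : nat -> X) (z : X)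
    : Prop :=
  exists phi : nat -> nat,
    strictly_increasing phi /\ mult_converges X d (fun k => u (phi k)) z.

(* [Rpower a b] is the real power only for [0 < a]; every base below is a value
   of [d] or a product of two such values, hence at least 1 when [d] is a
   multiplicative metric. *)
Definition mult_zamfirescu (X : Type) (d : X -> X -> R) (T : X -> X)
    (xi eta lambda : R) : Prop :=
  forall x y : X, x <> y ->
    d (T x) (T y) <= Rpower (d x y) xi \/
    d (T x) (T y) <= Rpower (d x (T x) * d y (T y)) eta \/
    d (T x) (T y) <= Rpower (d x (T y) * d y (T x)) lambda.

(* Main.v *)
(** The function [ln d] is an ordinary metric, for which the three conditions
    are the linear ones of Zamfirescu.  With
    [delta = max (xi, eta / (1 - eta), lambda / (1 - lambda)) < 1] they all give
    [rho (Tx) (Ty) <= delta * rho x y + 2 * delta * rho x (Tx)] and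
    [rho (Tx) (T (Tx)) <= delta * rho x (Tx)].  The second bound makes the
    orbit's consecutive distances decay geometrically; the first then shows that
    [T z1] is arbitrarily close to [z1], and that two fixed points coincide. *)

Require Import Defs.
From Stdlib Require Import Reals Lra Lia Classical.
Open Scope R_scope.

Lemma strictly_increasing_ge_id (phi : nat -> nat) :
  strictly_increasing phi -> forall n, (n <= phi n)%nat.
Proof.
  intros Hphi n; induction n as [|n IH]; [lia|].
  assert (H := Hphi n (S n) (Nat.lt_succ_diag_r n)); lia.
Qed.

Lemma ln_le_mono (x y : R) : 0 < x -> x <= y -> ln x <= ln y.
Proof.
  intros Hx [Hlt | <-]; [left; now apply ln_increasing | lra].
Qed.

Lemma ln_nonneg (x : R) : 1 <= x -> 0 <= ln x.
Proof.
  intros Hx; rewrite <- ln_1; apply ln_le_mono; lra.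
Qed.

Section LogDistance.

Context (M : Type) (d : M -> M -> R) (hd : multiplicative_metric M d).

Definition log_dist (x y : M) : R := ln (d x y).

Lemma dist_pos (x y : M) : 0 < d x y.
Proof. pose proof (mm_ge1 _ _ hd x y); lra. Qed.

Lemma log_dist_nonneg (x y : M) : 0 <= log_dist x y.
Proof. apply ln_nonneg; pose proof (mm_ge1 _ _ hd x y); lra. Qed.

Lemma log_dist_refl (x : M) : log_dist x x = 0.
Proof.
  unfold log_dist; rewrite (proj2 (mm_eq1 _ _ hd x x) eq_refl); exact ln_1.
Qed.

Lemma log_dist_eq0 (x y : M) : log_dist x y = 0 -> x = y.
Proof.
  intros H; apply (mm_eq1 _ _ hd).
  apply ln_inv; [apply dist_pos | lra | now rewrite ln_1].
Qed.

Lemma log_dist_sym (x y : M) : log_dist x y = log_dist y x.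
Proof. unfold log_dist; now rewrite (mm_sym _ _ hd). Qed.

Lemma log_dist_triangle (y x z : M) :
  log_dist x z <= log_dist x y + log_dist y z.
Proof.
  unfold log_dist; rewrite <- ln_mult by apply dist_pos.
  apply ln_le_mono; [apply dist_pos | apply (mm_triangle _ _ hd)].
Qed.

Lemma log_dist_le_of_Rpower (x y : M) (a b : R) :
  d x y <= Rpower a b -> log_dist x y <= b * ln a.
Proof.
  intros H; unfold log_dist.
  (* [Rpower a b] unfolds to [exp (b * ln a)], so this identity holds for every real [a]. *)
  replace (b * ln a) with (ln (Rpower a b)) by (unfold Rpower; apply ln_exp).
  apply ln_le_mono; [apply dist_pos | exact H].
Qed.

Lemma mult_converges_log (u : nat -> M) (z : M) (eps : R) :
  mult_converges M d u z -> 0 < eps ->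
  exists n0 : nat, forall n, (n0 <= n)%nat -> log_dist (u n) z < eps.
Proof.
  intros Hu Heps.
  assert (H1 : exp eps > 1) by (rewrite <- exp_0; now apply exp_increasing).
  destruct (Hu (exp eps) H1) as [n0 [_ Hn0]].
  exists n0; intros n Hn; rewrite <- (ln_exp eps).
  apply ln_increasing; [apply dist_pos | auto].
Qed.

Section Zamfirescu.

Context (T : M -> M) (xi eta lambda : R).
Context (hxi : 0 <= xi < 1) (heta : 0 <= eta < 1 / 2)
  (hlambda : 0 <= lambda < 1 / 2).
Context (hT : mult_zamfirescu M d T xi eta lambda).

Definition zamfirescu_rate : R :=
  Rmax xi (Rmax (eta / (1 - eta)) (lambda / (1 - lambda))).

Lemma div_one_minus_lt1 (a : R) : a < 1 / 2 -> a / (1 - a) < 1.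
Proof.
  intros Ha; apply (Rmult_lt_reg_r (1 - a)); [lra|].
  unfold Rdiv; rewrite Rmult_assoc, Rinv_l; lra.
Qed.

Lemma zamfirescu_rate_bounds : 0 <= zamfirescu_rate < 1.
Proof.
  split.
  - apply Rle_trans with xi; [lra | apply Rmax_l].
  - repeat apply Rmax_lub_lt; [lra | |]; apply div_one_minus_lt1; lra.
Qed.

(** The bounded quantity [r] recurs on the right; moving [a * r] to the left and dividing by
    [1 - a > 0] leaves the factor [a / (1 - a)]. *)
Lemma le_rate_of_absorbed (a r s : R) :
  a < 1 / 2 -> a / (1 - a) <= zamfirescu_rate -> 0 <= s ->
  r <= a * (s + r) -> r <= zamfirescu_rate * s.
Proof.
  intros Ha Hrate Hs Hr.
  apply Rle_trans with (a / (1 - a) * s); [|now apply Rmult_le_compat_r].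
  apply (Rmult_le_reg_l (1 - a)); [lra|].
  replace ((1 - a) * (a / (1 - a) * s)) with (a * s) by (field; lra); lra.
Qed.

(** Equal points satisfy the first alternative as [0 <= 0], so later arguments need not separate
    this case. *)
Lemma zamfirescu_log (x y : M) :
  log_dist (T x) (T y) <= xi * log_dist x y \/
  log_dist (T x) (T y) <= eta * (log_dist x (T x) + log_dist y (T y)) \/
  log_dist (T x) (T y) <= lambda * (log_dist x (T y) + log_dist y (T x)).
Proof.
  destruct (classic (x = y)) as [<- | Hxy].
  - left; rewrite !log_dist_refl; lra.
  (* Only the sums on the right of the last two alternatives are unfolded, to be merged into
     logarithms of products. *)
  - unfold log_dist at 4 5 7 8.
    rewrite <- !ln_mult by apply dist_pos.
    destruct (hT x y Hxy) as [H | [H | H]];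
      [left | right; left | right; right]; now apply log_dist_le_of_Rpower.
Qed.

(** Every distance issuing from [y] is rerouted through [x]. Conditions (2) and (3) then both give
    [r <= a * (s + r)] with [r = log_dist (T x) (T y)] and
    [s = log_dist x y + 2 * log_dist x (T x)]. Only the displacement of [x] remains, so [x] can be
    an orbit point. *)
Lemma zamfirescu_le (x y : M) :
  log_dist (T x) (T y) <=
    zamfirescu_rate * (log_dist x y + 2 * log_dist x (T x)).
Proof.
  pose proof (log_dist_nonneg x y); pose proof (log_dist_nonneg x (T x)).
  pose proof (log_dist_sym x y).
  destruct (zamfirescu_log x y) as [Hc | [Hc | Hc]].
  - apply Rle_trans with (xi * log_dist x y); [exact Hc|].
    apply Rmult_le_compat; [lra | lra | apply Rmax_l | lra].
  - apply (le_rate_of_absorbed eta); [lra | | lra |].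
    + eapply Rle_trans; [apply Rmax_l | apply Rmax_r].
    + eapply Rle_trans; [exact Hc | apply Rmult_le_compat_l; [lra|]].
      pose proof (log_dist_triangle x y (T y)).
      pose proof (log_dist_triangle (T x) x (T y)); lra.
  - apply (le_rate_of_absorbed lambda); [lra | | lra |].
    + eapply Rle_trans; [apply Rmax_r | apply Rmax_r].
    + eapply Rle_trans; [exact Hc | apply Rmult_le_compat_l; [lra|]].
      pose proof (log_dist_triangle (T x) x (T y)).
      pose proof (log_dist_triangle x y (T x)); lra.
Qed.

(** Putting [y = T x] in [zamfirescu_le] would only give the factor [3 * zamfirescu_rate], which may
    exceed 1, so the three alternatives are reexamined. In the third, the distance from [T x] to
    itself vanishes. *)
Lemma zamfirescu_step_le (x : M) :
  log_dist (T x) (T (T x)) <= zamfirescu_rate * log_dist x (T x).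
Proof.
  pose proof (log_dist_nonneg x (T x)).
  destruct (zamfirescu_log x (T x)) as [Hc | [Hc | Hc]].
  - eapply Rle_trans; [exact Hc|].
    apply Rmult_le_compat_r; [lra | apply Rmax_l].
  - apply (le_rate_of_absorbed eta); [lra | | lra | exact Hc].
    eapply Rle_trans; [apply Rmax_l | apply Rmax_r].
  - apply (le_rate_of_absorbed lambda); [lra | | lra |].
    + eapply Rle_trans; [apply Rmax_r | apply Rmax_r].
    + eapply Rle_trans; [exact Hc | apply Rmult_le_compat_l; [lra|]].
      pose proof (log_dist_triangle (T x) x (T (T x))).
      rewrite (log_dist_refl (T x)); lra.
Qed.

Lemma zamfirescu_orbit_le (x : M) (n : nat) :
  log_dist (Nat.iter n T x) (T (Nat.iter n T x)) <=
    zamfirescu_rate ^ n * log_dist x (T x).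
Proof.
  pose proof zamfirescu_rate_bounds as Hrate.
  induction n as [|n IH]; cbn [Nat.iter nat_rect pow]; [lra|].
  eapply Rle_trans; [apply zamfirescu_step_le|].
  rewrite Rmult_assoc; apply Rmult_le_compat_l; [lra | exact IH].
Qed.

Lemma zamfirescu_orbit_small (x : M) (eps : R) :
  0 < eps -> exists N : nat, forall n, (N <= n)%nat ->
    log_dist (Nat.iter n T x) (T (Nat.iter n T x)) < eps.
Proof.
  intros Heps.
  pose proof zamfirescu_rate_bounds as Hrate.
  pose proof (log_dist_nonneg x (T x)) as Hx.
  set (c := log_dist x (T x)) in *.
  assert (Habs : Rabs zamfirescu_rate < 1) by (rewrite Rabs_pos_eq; lra).
  (* Dividing by [c + 1] keeps the quotient meaningful when [c = 0], that is, when [x] is already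
     fixed. *)
  assert (Hc : 0 < eps / (c + 1)) by (apply Rdiv_lt_0_compat; lra).
  destruct (pow_lt_1_zero _ Habs _ Hc) as [N HN].
  exists N; intros n Hn.
  eapply Rle_lt_trans; [apply zamfirescu_orbit_le|]; fold c.
  specialize (HN n Hn).
  assert (Hpow : 0 <= zamfirescu_rate ^ n) by (apply pow_le; lra).
  rewrite Rabs_pos_eq in HN by exact Hpow.
  apply (Rmult_lt_compat_r (c + 1)) in HN; [|lra].
  replace (eps / (c + 1) * (c + 1)) with eps in HN by (field; lra); lra.
Qed.

Lemma zamfirescu_fixed_unique (z w : M) : T z = z -> T w = w -> z = w.
Proof.
  intros Hz Hw.
  pose proof zamfirescu_rate_bounds as Hrate.
  pose proof (log_dist_nonneg z w) as Hzw.
  pose proof (zamfirescu_le z w) as H.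
  rewrite Hz, Hw, (log_dist_refl z) in H.
  apply log_dist_eq0; nra.
Qed.

(** Follow the path [z], [x], [T x], [T z]: by [zamfirescu_le] and a rate below 1, the last leg
    costs at most [log_dist x z + 2 * log_dist x (T x)]. *)
Lemma zamfirescu_displacement_le (x z : M) :
  log_dist z (T z) <= 2 * log_dist x z + 3 * log_dist x (T x).
Proof.
  pose proof zamfirescu_rate_bounds as Hrate.
  pose proof (log_dist_nonneg x z); pose proof (log_dist_nonneg x (T x)).
  pose proof (log_dist_triangle x z (T z)).
  pose proof (log_dist_triangle (T x) x (T z)).
  pose proof (log_dist_sym z x).
  pose proof (zamfirescu_le x z).
  nra.
Qed.

Lemma zamfirescu_limit_point_fixed (x z : M) :
  mult_limit_point M d (fun n => Nat.iter n T x) z -> T z = z.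
Proof.
  intros [phi [Hphi Hconv]].
  symmetry; apply log_dist_eq0.
  apply Rle_antisym; [|apply log_dist_nonneg].
  apply le_epsilon; intros eps Heps.
  (* The 5 is the sum of the coefficients 2 and 3 in [zamfirescu_displacement_le]. *)
  assert (Heps5 : 0 < eps / 5) by lra.
  destruct (mult_converges_log _ _ _ Hconv Heps5) as [N1 HN1].
  destruct (zamfirescu_orbit_small x (eps / 5) Heps5) as [N2 HN2].
  pose (k := Nat.max N1 N2).
  (* Since [k <= phi k], the index [phi k] also passes the threshold [N2] of the full orbit. *)
  pose proof (strictly_increasing_ge_id phi Hphi k) as Hk.
  specialize (HN1 k ltac:(lia)); specialize (HN2 (phi k) ltac:(lia)).
  pose proof (zamfirescu_displacement_le (Nat.iter (phi k) T x) z).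
  cbv beta in HN1; lra.
Qed.

End Zamfirescu.

End LogDistance.

Theorem theorem3p2 (M : Type) (d : M -> M -> R) (xi eta lambda : R)
    (T : M -> M)
    (hd : multiplicative_metric M d)
    (hxi : 0 <= xi < 1) (heta : 0 <= eta < 1 / 2) (hlambda : 0 <= lambda < 1 / 2)
    (hT : mult_zamfirescu M d T xi eta lambda)
    (x0 z1 : M)
    (hz1 : mult_limit_point M d (fun n : nat => Nat.iter n T x0) z1) :
  unique (fun z : M => T z = z) z1.
Proof.
  assert (Hz1 : T z1 = z1)
    by exact (zamfirescu_limit_point_fixed M d hd T xi eta lambda
      hxi heta hlambda hT x0 z1 hz1).
  split; [exact Hz1|].
  intros w Hw.
  exact (zamfirescu_fixed_unique M d hd T xi eta lambda
    hxi heta hlambda hT z1 w Hz1 Hw).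
Qed.
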